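(* Let $G = (\mathbb{Z}/n_1\mathbb{Z}) \oplus (\mathbb{Z}/n_2\mathbb{Z}) \oplus \cdots \oplus (\mathbb{Z}/n_m\mathbb{Z})$, of order $n=n_1n_2\cdots n_m$, and let $K$ be a number field contained in $\mathbb{Q}(\zeta_n)$. Then there are at most $2^{r(G,K)}$ Cayley digraphs $D(G,S)$ on $G$ (with $S\subseteq G\setminus\{0\}$) that are algebraically integral over $K$, where $$r(G,K) = \sum_{P\in P_G} \frac{\prod_{i=1}^m [\mathbb{Q}(\zeta_{n_i}^{a_i}) : \mathbb{Q}(\zeta_{n_i}^{a_i})\cap K]}{[\mathbb{Q}(P):\mathbb{Q}(P)\cap K]},$$ where for each $P \in P_G$ an element $(a_1,\dots,a_m)\in P$ is chosen, and $P_G$ and $\mathbb{Q}(P)$ are as defined in the context.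
   Context: $\zeta_k$ denotes a primitive $k$-th root of unity. For a group $G$ and a subset $S$ of $G$ not containing the identity, the Cayley digraph $D(G,S)$ has vertex set $G$ and a directed edge from $g$ to $h$ exactly when $hg^{-1}\in S$ (in additive notation, $h-g\in S$). A digraph is called algebraically integral over a number field $K$ if all eigenvalues of its adjacency matrix are algebraic integers lying in $K$. Let $H = \mathrm{Gal}(\mathbb{Q}(\zeta_n)/K)$. Each $\sigma\in H$ corresponds to an element $a\in(\mathbb{Z}/n\mathbb{Z})^*$ with $\sigma(\zeta_n)=\zeta_n^a$, and $\sigma$ acts on $\mathbb{Z}/n_i\mathbb{Z}$ by $\sigma(x)=ax \pmod{n_i}$. For $1\le i\le m$ let $G_{n_i}$ be the set of all orbits of $\mathbb{Z}/n_i\mathbb{Z}$ under $H$ (including the orbit $\{0\}$). Let $P_G$ be the collection of all Cartesian products $P = p_1\times p_2\times\cdots\times p_m$ with $p_i\in G_{n_i}$ and $P\ne\{(0,\dots,0)\}$. For $P\in P_G$ choose an element $(a_1,\dots,a_m)\in P$ and define $\mathbb{Q}(P) = \mathbb{Q}(\zeta_{n_1}^{a_1},\zeta_{n_2}^{a_2},\dots,\zeta_{n_m}^{a_m})$. This field, and the fields $\mathbb{Q}(\zeta_{n_i}^{a_i})$, do not depend on the choice of the element of $P$. *)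

(* Defs.v *)
From HB Require Import structures.
From mathcomp Require Import all_boot all_order all_fingroup all_algebra all_field.
From mathcomp Require Import boolp reals exp.

Set Implicit Arguments.
Unset Strict Implicit.
Unset Printing Implicit Defensive.

Import GRing.Theory.

Local Open Scope ring_scope.

(* A digraph on a finite vertex set V is given by its set of arcs. *)
Definition adjacency (V : finType) (D : {set V * V}) : 'M[algC]_#|V| :=
  \matrix_(i, j) ((enum_val i, enum_val j) \in D)%:R.

Definition cayley_digraph (gT : finGroupType) (S : {set gT}) :
    {set gT * gT} :=
  [set e | (e.2 * e.1^-1)%g \in S].

(* The number field is a subfield K of an ambient finite extension L of Q.
   The eigenvalues are algebraic, hence lie in algC, and K is compared with
   them through an embedding iota of L in algC. *)
Definition alg_integral_over (L : fieldExtType rat) (iota : {rmorphism L -> algC})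
    (K : {subfield L}) (V : finType) (D : {set V * V}) : Prop :=
  forall x : algC, eigenvalue (adjacency D) x ->
    x \in Aint /\ exists2 y : L, y \in K & iota y = x.

(* Z/kZ for every k > 0, including k = 1, for which 'Z_k would be Z/2Z. *)
Notation Zmod k := 'I_(k.-1.+1).

(* The direct sum of the Z/(n i)Z.  The library's group law on it, written
   multiplicatively, is componentwise addition, so 1%g is (0, ..., 0). *)
Notation sumZ n := {dffun forall i, Zmod (n i)}.

(* The orbit of x under Gal(Q(z)/K), for z a primitive N-th root of unity and
   k a divisor of N: if s z = z ^+ a, then s sends x to a x mod k. *)
Definition gal_orbit (L : splittingFieldType rat) (N : nat) (z : L)
    (K : {subfield L}) (k : nat) (x : Zmod k) : {set Zmod k} :=
  [set y | [exists s in ('Gal(<<1; z>> / K))%g, exists a : 'I_N,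
     [&& coprime a N, s z == z ^+ a & y == x *+ a]]].

Definition gal_orbits (L : splittingFieldType rat) (N : nat) (z : L)
    (K : {subfield L}) (k : nat) : {set {set Zmod k}} :=
  [set gal_orbit N z K x | x : Zmod k].

Definition orbit_products (m : nat) (n : 'I_m -> nat)
    (L : splittingFieldType rat) (z : L) (K : {subfield L}) :
    {set {set sumZ n}} :=
  [set setXn p | p : {dffun forall i, {set Zmod (n i)}}
     & [forall i, p i \in gal_orbits (\prod_j n j)%N z K (n i)]] :\ [set 1%g].

(* [E : E \cap K] *)
Definition degree_over (L : fieldExtType rat) (E K : {subfield L}) : nat :=
  \dim_(E :&: K) E.

(* w i is the chosen primitive (n i)-th root of unity, and a P the chosen
   element of P. *)
Definition rGK (m : nat) (n : 'I_m -> nat) (L : splittingFieldType rat)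
    (z : L) (w : 'I_m -> L) (K : {subfield L})
    (a : {set sumZ n} -> sumZ n) : rat :=
  \sum_(P in orbit_products n z K)
    (\prod_i degree_over <<1; w i ^+ a P i>> K)%:R /
    (degree_over <<1 & [seq w i ^+ a P i | i : 'I_m]>> K)%:R.

(* Main.v *)
Require Import Defs.
From HB Require Import structures.
From mathcomp Require Import all_boot all_order all_fingroup all_algebra all_field.
From mathcomp Require Import boolp reals exp.

Set Implicit Arguments.
Unset Strict Implicit.
Unset Printing Implicit Defensive.

Import GRing.Theory.

Local Open Scope ring_scope.

(* A K-integral Cayley digraph has all its eigenvalues, the character sums of S,
   fixed by H = Gal(Q(z)/K).  An element s of H with s z = z ^+ e sends the
   character sums of S to those of its image under x |-> e x, and a set is
   determined by its character sums, so S is a union of H-orbits on G \ {0} and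
   there are at most 2 ^ r such sets, r being the number of these orbits.  By
   Galois theory the orbits inside a product P of component orbits all have
   [Q(P) : Q(P) \cap K] elements, while the i-th factor of P has
   [Q(w_i ^ a_i) : Q(w_i ^ a_i) \cap K]; dividing counts the orbits in P. *)

(** * Degrees as indices in an abelian Galois extension *)

(** By the Galois connection, [A] and [B] both lie in the Galois group over the intersection of
    their fixed fields, hence so does their join. *)
Lemma capv_fixedField (F : fieldType) (L : splittingFieldType F)
    (E : {subfield L}) (A B : {group gal_of E}) :
  fixedField (A <*> B)%g = (fixedField A :&: fixedField B)%VS.
Proof.
apply/eqP; rewrite eqEsubv subv_cap -andbA; apply/and3P; split.
- by rewrite fixedFieldS ?joing_subl.
- by rewrite fixedFieldS ?joing_subr.
have sKE : (fixedField A :&: fixedField B <= E)%VS.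
  by rewrite (subv_trans (capvSl _ _)) ?capvSl.
rewrite -[X in (X <= _)%VS]/(val (fixedField_aspace A :&: fixedField_aspace B)%AS).
rewrite -galois_connection // join_subG !galois_connection //.
by rewrite capvSl capvSr.
Qed.

(* Natural irrationalities, read off from the index formula
   |A : A :&: B| = |AB| / |B| for A = Gal(E/K) and B = Gal(E/M). *)
Lemma index_gal_abelian (F : fieldType) (L : splittingFieldType F)
    (E K M : {subfield L}) :
    galois 1 E -> abelian 'Gal(E / 1%VS)%g -> (K <= E)%VS -> (M <= E)%VS ->
  #|'Gal(E / K) : 'Gal(E / M)|%g = \dim_(M :&: K) M.
Proof.
move=> gal1E cGG sKE sME.
have galE (U : {subfield L}) : (U <= E)%VS -> galois U E.
  by move=> sUE; apply: (galoisS (K := 1%AS) _ gal1E); rewrite sub1v sUE.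
(* Normality makes the product of the two Galois groups a group, namely their join, whose fixed
   field is [M :&: K]. *)
have nKM : ('Gal(E / K) \subset 'N('Gal(E / M)))%g.
  by apply/cents_norm/(centSS _ _ cGG); rewrite galS ?sub1v.
have card_gal (U : {subfield L}) (sUE : (U <= E)%VS) := galois_dim (galE U sUE).
have joinE : ('Gal(E / M :&: K) = 'Gal(E / K) * 'Gal(E / M))%g.
  rewrite -norm_joinEl // -[RHS](gal_fixedField ('Gal(E / K) <*> 'Gal(E / M))%G).
  rewrite capv_fixedField.
  by rewrite (galois_fixedField (galE K sKE)) (galois_fixedField (galE M sME)) capvC.
have sFE : (M :&: K <= E)%VS by rewrite (subv_trans (capvSl _ _)).
have card_cap :
    #|'Gal(E / M :&: K)%g| = (#|'Gal(E / K) : 'Gal(E / M)|%g * #|'Gal(E / M)%g|)%N.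
  have := mul_cardG 'Gal(E / K)%G 'Gal(E / M)%G.
  rewrite -joinE -(LagrangeI 'Gal(E / K)%G 'Gal(E / M)%G) [X in _ = X]mulnC -mulnA.
  by move/eqP; rewrite eqn_pmul2l ?cardG_gt0 // => /eqP.
apply/eqP; rewrite -(eqn_pmul2r (cardG_gt0 'Gal(E / M)%G)) -card_cap.
rewrite -(card_gal _ sME) -(card_gal [aspace of (M :&: K)%VS] sFE) /=.
rewrite -(eqn_pmul2r (adim_gt0 (M :&: K)%AS)) /= divnK ?field_dimS //.
by rewrite mulnAC divnK ?field_dimS ?capvSl // mulnC divnK ?field_dimS.
Qed.

(** * The cyclotomic Galois group and its action by powers *)

Section GalPrimRoot.

Variables (L : splittingFieldType rat) (N : nat) (z : L).
Hypothesis z_prim : N.-primitive_root z.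

Let E : {subfield L} := <<1; z>>%AS.
Let z_in_E : z \in E. Proof. exact: memv_adjoin. Qed.

Implicit Types s t : gal_of E.

Lemma unity_root_in_adjoin (r : L) : r ^+ N = 1 -> r \in E.
Proof. by case/(prim_rootP z_prim) => i ->; rewrite rpredX. Qed.

Lemma galois_prim_root : galois 1 E.
Proof.
apply/splitting_galoisField; exists ('X^N - 1); split.
- by rewrite rpredB ?rpredX ?polyOverX ?rpred1.
- apply: separable_Xn_sub_1; rewrite -(rmorph_nat (in_alg L)) fmorph_eq0.
  by rewrite Num.Theory.pnatr_eq0 -lt0n (prim_order_gt0 z_prim).
exists [seq z ^+ i | i <- index_iota 0 N].
  by rewrite -(factor_Xn_sub_1 z_prim) big_map eqpxx.
apply/eqP; rewrite eqEsubv; apply/andP; split.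
  by apply/Fadjoin_seqP; split=> [|_ /mapP[i _ ->]]; rewrite ?sub1v ?rpredX.
apply/FadjoinP; split; first exact: sub1v.
(* For [N = 1] the list of powers is reduced to [z ^+ 0], and [1 %% N] is then 0. *)
have zN : z ^+ 1 = z ^+ (1 %% N) by rewrite (prim_expr_mod z_prim).
apply: seqv_sub_adjoin; apply/mapP; exists (1 %% N)%N; last exact: zN.
by rewrite mem_index_iota ltn_mod (prim_order_gt0 z_prim).
Qed.

(** A representative of the cyclotomic character at [s], meaningful mod [N]; as [z] is primitive,
    the default 0 is never taken. *)
Definition gal_exp s : nat :=
  if [pick i : 'I_N | s z == z ^+ i] is Some i then i else 0%N.

Lemma gal_expE s : s z = z ^+ gal_exp s.
Proof.
rewrite /gal_exp; case: pickP => [i /eqP // | nos].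
have szN : (s z) ^+ N = 1 by rewrite -rmorphXn /= (prim_expr_order z_prim) rmorph1.
by have [i szi] := prim_rootP z_prim szN; have := nos i; rewrite szi eqxx.
Qed.

Lemma gal_unity_root s (r : L) : r ^+ N = 1 -> s r = r ^+ gal_exp s.
Proof.
case/(prim_rootP z_prim) => i ->.
by rewrite rmorphXn /= gal_expE -!exprM mulnC.
Qed.

Lemma gal_exp_eqmod s k : s z = z ^+ k -> gal_exp s = k %[mod N].
Proof. by rewrite gal_expE => /eqP; rewrite (eq_prim_root_expr z_prim) => /eqP. Qed.

Lemma gal_exp1 : gal_exp 1%g = 1 %[mod N].
Proof. by apply: gal_exp_eqmod; rewrite gal_id expr1. Qed.

Lemma gal_expM s t : gal_exp (s * t)%g = gal_exp s * gal_exp t %[mod N].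
Proof.
apply: gal_exp_eqmod; rewrite galM // gal_expE rmorphXn /= gal_expE.
by rewrite -exprM mulnC.
Qed.

(** The exponent of [s^-1] is an inverse mod [N]. *)
Lemma gal_exp_coprime s : coprime (gal_exp s) N.
Proof.
have zV : z ^+ (gal_exp s * gal_exp s^-1%g) = z ^+ 1.
  apply/eqP; rewrite (eq_prim_root_expr z_prim) -gal_expM mulgV.
  by rewrite gal_exp1 eqxx.
move/eqP: zV; rewrite (eq_prim_root_expr z_prim) => /eqP eV.
have : coprime (gal_exp s * gal_exp s^-1%g) N by rewrite -coprime_modl eV coprime_modl coprime1n.
by rewrite coprimeMl => /andP[].
Qed.

Lemma abelian_gal_prim_root : abelian 'Gal(E / 1%VS)%g.
Proof.
apply/centsP => s _ t _.
have gs u : u \in 'Gal(E / 1%VS)%g by rewrite gal_kHom ?sub1v // k1HomE ahomWin.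
apply/eqP; rewrite (gal_adjoin_eq (gs _) (gs _)) !galM //.
by rewrite !gal_expE !rmorphXn /= !gal_expE -!exprM mulnC.
Qed.

Section Action.

Variable gT : finGroupType.
Hypothesis gT_exp : forall x : gT, (x ^+ N = 1)%g.

Lemma expg_eqmod (x : gT) i j : i = j %[mod N] -> (x ^+ i = x ^+ j)%g.
Proof. by move=> eij; rewrite -(expg_mod i (gT_exp x)) eij expg_mod. Qed.

Lemma gal_power1 : (fun x : gT => x ^+ gal_exp 1)%g =1 id.
Proof. by move=> x; rewrite (expg_eqmod x gal_exp1) expg1. Qed.

Lemma gal_powerM (x : gT) : act_morph (fun x s => x ^+ gal_exp s)%g x.
Proof. by move=> s t; rewrite (expg_eqmod x (gal_expM s t)) expgM. Qed.

(** Additively, multiplication by the class of [gal_exp s]. Exponents multiply only mod [N], hence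
    the condition that [N] kills [gT]. *)
Definition gal_power : {action gal_of E &-> gT} :=
  @TotalAction _ _ (fun x s => x ^+ gal_exp s)%g gal_power1 gal_powerM.

Lemma gal_powerE x s : gal_power x s = (x ^+ gal_exp s)%g.
Proof. by []. Qed.

(* The hypothesis on rs says that x and Q(rs) have the same stabilizer. *)
Lemma card_orbit_gal_power (K : {subfield L}) (rs : seq L) (x : gT) :
    (K <= E)%VS -> (forall r, r \in rs -> r ^+ N = 1) ->
    (forall e, (x ^+ e = x)%g <-> forall r, r \in rs -> r ^+ e = r) ->
  #|orbit gal_power 'Gal(E / K) x| = degree_over <<1 & rs>> K.
Proof.
move=> sKE rsN stabx.
have sME : (<<1 & rs>> <= E)%VS.
  by apply/Fadjoin_seqP; split=> [|r /rsN /unity_root_in_adjoin //]; rewrite sub1v.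
rewrite card_orbit /degree_over.
rewrite -(index_gal_abelian galois_prim_root abelian_gal_prim_root sKE sME).
(* Inside [Gal(E / K)], the stabilizer of [x] is cut out by [Gal(E / <<1 & rs>>)]. *)
rewrite -[RHS]indexgI; congr #|_ : _|%g; apply/setP => s; rewrite !inE.
case: (s \in 'Gal(E / K)%g) => //=.
rewrite sub1set inE /=; apply/eqP/idP => [/stabx fix_rs | sM].
  rewrite -sub1set galois_connection //; apply/Fadjoin_seqP; split=> [|r rsr].
    exact: sub1v.
  apply/fixedFieldP; first exact/unity_root_in_adjoin/rsN.
  by move=> _ /set1P->; rewrite gal_unity_root ?rsN ?fix_rs.
apply/stabx => r rsr; rewrite -gal_unity_root ?rsN //.
by apply: (fixed_gal sME sM); apply: seqv_sub_adjoin.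
Qed.

End Action.

End GalPrimRoot.

(** * Eigenvalues of Cayley digraphs *)

(* The left eigenvector is the inverse character g |-> f g^-1. *)
Lemma eigenvalue_cayley (gT : finGroupType) (S : {set gT}) (f : gT -> algC) :
    f 1%g = 1 -> {morph f : x y / (x * y)%g >-> x * y} ->
  eigenvalue (adjacency (cayley_digraph S)) (\sum_(s in S) f s).
Proof.
move=> f1 fM; apply/eigenvalueP.
exists (\row_i f (enum_val i)^-1%g); last first.
  apply/eqP => /rowP/(_ (enum_rank 1%g)); rewrite !mxE enum_rankK invg1 f1.
  by move/eqP; rewrite oner_eq0.
apply/rowP => j; rewrite !mxE; set g := enum_val j.
rewrite (reindex_onto (@enum_rank gT) enum_val) /=; last by move=> i _; rewrite enum_valK.
under eq_bigl do rewrite enum_rankK eqxx.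
(* The arcs into [g] start at the vertices [s^-1 * g] with [s] in [S], so the sum over sources is
   indexed by [s]. *)
rewrite (reindex_inj (inj_comp (mulIg g) invg_inj)) /=.
rewrite mulrC big_distrr big_mkcond [in RHS]big_mkcond /=; apply: eq_bigr => s _.
rewrite !mxE enum_rankK inE /= -/g invMg invgK fM mulKVg.
by case: (s \in S); rewrite ?mulr1 ?mulr0.
Qed.

(** * Invariant sets and orbits *)

(** An invariant set is the union of its orbits, so it is determined by the set of these orbits. *)
Lemma card_acts_le (aT : finGroupType) (rT : finType) (to : {action aT &-> rT})
    (G : {group aT}) (A : {set rT}) :
  (#|[set S : {set rT} | (S \subset A) && [acts G, on S | to]]|
     <= 2 ^ #|orbit to G @: A|)%N.
Proof.
rewrite -card_powerset -(@card_in_imset _ _ (fun S : {set rT} => orbit to G @: S)).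
  apply/subset_leq_card/subsetP => _ /imsetP[S /[!inE] /andP[sSA _] ->].
  exact: imsetS.
move=> S T /[!inE] /andP[_ actS] /andP[_ actT] eqST.
by rewrite -(cover_partition (orbit_partition actS)) eqST (cover_partition (orbit_partition actT)).
Qed.

(** Makes orbit counting available for [gal_orbit]: multiples and group powers agree in [Zmod k],
    and exponents count only mod [N]. *)
Lemma gal_orbitE (L : splittingFieldType rat) (N : nat) (z : L)
    (z_prim : N.-primitive_root z) (k : nat)
    (expN : forall x : Zmod k, (x ^+ N = 1)%g) (K : {subfield L}) (x : Zmod k) :
  gal_orbit N z K x = orbit (gal_power z_prim expN) 'Gal(<<1; z>> / K)%g x.
Proof.
apply/setP => y; rewrite inE; apply/existsP/orbitP => [[s] | [s Ks <-]].
  case/andP => Ks /existsP[i /and3P[_ /eqP szi /eqP ->]]; exists s => //=.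
  rewrite (expg_eqmod expN x (gal_exp_eqmod z_prim szi)).
  by rewrite Zp_expg Zp_mulrn.
have N_gt0 := prim_order_gt0 z_prim.
exists s; rewrite Ks /=; apply/existsP.
exists (Ordinal (ltn_pmod (gal_exp N s) N_gt0)); rewrite /=.
rewrite coprime_modl gal_exp_coprime //= (prim_expr_mod z_prim) -gal_expE // eqxx /=.
by rewrite Zp_mulrn -Zp_expg (expg_mod _ (expN x)).
Qed.

(** * Powers of a primitive root indexed by [Zmod k] *)

Section Zmod.

Variables (L : fieldType) (k : nat) (w : L).
Hypothesis w_prim : k.-primitive_root w.
Implicit Types x y : Zmod k.

Let Zmod_cardK : k.-1.+1 = k. Proof. exact/prednK/(prim_order_gt0 w_prim). Qed.

Lemma modn_Zmod i : (i %% k.-1.+1 = i %% k)%N. Proof. by rewrite Zmod_cardK. Qed.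

Lemma prim_root_Zmod_mod i : w ^+ (i %% k.-1.+1) = w ^+ i.
Proof. by rewrite Zmod_cardK (prim_expr_mod w_prim). Qed.

Lemma Zmod_expg x N : (k %| N)%N -> (x ^+ N = 1)%g.
Proof.
case/dvdnP => q ->; apply/val_inj; rewrite Zp_expg /= mulnA.
by rewrite -[X in (_ * X)%N]Zmod_cardK modnMl.
Qed.

(** Both sides mean [x * e = x] mod [k]. This feeds the stabilizer hypothesis of
    [card_orbit_gal_power]. *)
Lemma Zmod_expg_fix x e : (x ^+ e = x)%g <-> (w ^+ x) ^+ e = w ^+ x.
Proof.
have eqx : (inZp (x * e) == x :> Zmod k) = (x * e == x %[mod k]).
  by rewrite -val_eqE /= modn_Zmod -(modn_Zmod x) (modn_small (ltn_ord x)).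
rewrite Zp_expg -exprM; split => [/eqP | /eqP].
  by rewrite eqx -(eq_prim_root_expr w_prim) => /eqP.
by rewrite (eq_prim_root_expr w_prim) -eqx => /eqP.
Qed.

End Zmod.

(** * Characters of the direct sum and Fourier inversion *)

Section SumZ.

Variables (m : nat) (n : 'I_m -> nat) (L : splittingFieldType rat) (w : 'I_m -> L).
Hypothesis w_prim : forall i, (n i).-primitive_root (w i).
Local Notation G := (sumZ n).
Local Notation N := (\prod_i n i)%N.
Implicit Types (b g h : G) (S : {set G}).

(** The characters of [G], indexed by [G] itself through [w]. Their values are in [L], where the
    Galois group acts. *)
Definition sum_char b g : L := \prod_i w i ^+ (b i * g i).

Lemma sum_charC b g : sum_char b g = sum_char g b.
Proof. by apply: eq_bigr => i _; rewrite mulnC. Qed.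

Lemma sum_char1 b : sum_char b 1%g = 1.
Proof. by apply: big1 => i _; rewrite oneg_ffun muln0. Qed.

Lemma sum_charM b : {morph sum_char b : g h / (g * h)%g >-> g * h}.
Proof.
move=> g h; rewrite -big_split; apply: eq_bigr => i _ /=.
by rewrite mulg_ffun mulnC exprM (prim_root_Zmod_mod (w_prim i)) -exprM mulnC mulnDr exprD.
Qed.

Lemma sum_charX b g e : sum_char b (g ^+ e)%g = sum_char b g ^+ e.
Proof. by elim: e => [|e IHe]; rewrite ?sum_char1 // expgS sum_charM IHe exprS. Qed.

Lemma sum_char_nontrivial g : g != 1%g -> exists b, sum_char b g != 1.
Proof.
move=> g_neq1; have [i gi] : exists i, g i != 0.
  apply/existsP; rewrite -negb_forall; apply: contraNN g_neq1 => /forallP g0.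
  by apply/eqP/ffunP => i; rewrite oneg_ffun; apply/eqP/g0.
(* The [i]-th unit vector gives the value [w i ^+ g i], which is not 1 because [0 < g i < n i]. *)
exists [ffun j => inZp (j == i)]; rewrite /sum_char (bigD1 i) //= big1 => [|j /negPf ji].
  rewrite mulr1 ffunE eqxx exprM (prim_root_Zmod_mod (w_prim i)) expr1.
  rewrite -(expr0 (w i)) (eq_prim_root_expr (w_prim i)).
  by rewrite mod0n -(modn_Zmod (w_prim i)) modn_small.
by rewrite ffunE ji /= mod0n mul0n.
Qed.

(** Multiplying the sum by a value [sum_char b0 g] other than 1 only permutes its terms, so it
    vanishes. *)
Lemma sum_char_ortho g : \sum_b sum_char b g = (if g == 1%g then #|G|%:R else 0).
Proof.
case: eqP => [-> | /eqP/sum_char_nontrivial[b0 b0g]].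
  by under eq_bigr do rewrite sum_char1; rewrite sumr_const.
apply/eqP; have : (sum_char b0 g - 1) * \sum_b sum_char b g == 0.
  rewrite mulrBl mul1r subr_eq0 big_distrr /= [X in _ == X](reindex_inj (mulgI b0)).
  by apply/eqP/eq_bigr => b _; rewrite ![sum_char _ g]sum_charC sum_charM.
by rewrite mulf_eq0 subr_eq0 (negPf b0g).
Qed.

(** Fourier inversion recovers [#|G|] times the indicator of a set, and [#|G|] is nonzero in
    characteristic 0. *)
Lemma fourier_set_inj (S T : {set G}) :
  (forall b, \sum_(g in S) sum_char b g = \sum_(g in T) sum_char b g) -> S = T.
Proof.
have inversion (U : {set G}) h :
    \sum_b sum_char b h^-1%g * \sum_(g in U) sum_char b g = (h \in U)%:R * #|G|%:R.
  under eq_bigr do rewrite big_distrr /=.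
  rewrite exchange_big /=.
  under eq_bigr => g _ do under eq_bigr => b _ do rewrite -sum_charM.
  under eq_bigr => g _ do rewrite sum_char_ortho -eq_mulVg1.
  rewrite big_mkcond (bigD1 h) //= eqxx big1 => [|g /negPf gh].
    by case: (h \in U); rewrite ?mul1r ?mul0r addr0.
  by rewrite eq_sym gh if_same.
move=> eqST; apply/setP => h.
have natL0 k : (k%:R == 0 :> L) = (k == 0)%N.
  by rewrite -(rmorph_nat (in_alg L)) fmorph_eq0 Num.Theory.pnatr_eq0.
have := inversion S h; under eq_bigr do rewrite eqST; rewrite inversion.
have G_neq0 : #|G|%:R != 0 :> L by rewrite natL0 -lt0n; apply/card_gt0P; exists 1%g.
move/(mulIf G_neq0); case: (h \in S); case: (h \in T) => // /eqP.
  by rewrite eq_sym oner_eq0.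
by rewrite oner_eq0.
Qed.

Lemma sumZ_expgE g e i : (g ^+ e)%g i = (g i ^+ e)%g.
Proof. by elim: e => [|e IHe]; rewrite ?oneg_ffun // !expgS mulg_ffun IHe. Qed.

Lemma sumZ_expg g : (g ^+ N = 1)%g.
Proof.
apply/ffunP => i; rewrite sumZ_expgE oneg_ffun (Zmod_expg (w_prim i)) //.
by rewrite (bigD1 i) //= dvdn_mulr.
Qed.

(** * Galois orbits on the direct sum *)

Variable z : L.
Hypothesis z_prim : N.-primitive_root z.
Variable K : {subfield L}.
Hypothesis sKz : (K <= <<1; z>>)%VS.

Local Notation H := 'Gal(<<1; z>> / K)%g.
Local Notation to := (gal_power z_prim sumZ_expg).

Let expw i : w i ^+ N = 1.
Proof. by rewrite (bigD1 i) //= exprM (prim_expr_order (w_prim i)) expr1n. Qed.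

(** Character values are [N]-th roots of unity, so [s] raises them to the power [gal_exp s], which
    moves into the argument. *)
Lemma gal_sum_char (s : gal_of <<1; z>>) b g : s (sum_char b g) = sum_char b (to g s).
Proof.
rewrite gal_powerE sum_charX -(gal_unity_root z_prim) //.
rewrite -prodrXl big1 // => i _; by rewrite -exprM mulnC exprM expw expr1n.
Qed.

Lemma acts_of_integral (iota : {rmorphism L -> algC}) S :
  alg_integral_over iota K (cayley_digraph S) -> [acts H, on S | to].
Proof.
move=> intS; apply/subsetP => s Hs; apply/astabsP => x.
have fixS b : s (\sum_(g in S) sum_char b g) = \sum_(g in S) sum_char b g.
  apply: (fixed_gal sKz Hs).
  have /intS[_ [y Ky]] : eigenvalue (adjacency (cayley_digraph S))
      (\sum_(g in S) iota (sum_char b g)).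
    by apply: eigenvalue_cayley => [|g h]; rewrite ?sum_char1 ?rmorph1 // sum_charM rmorphM.
  (* Injectivity of [iota] brings the eigenvalue back to [L], where it lies in [K]. *)
  by rewrite -rmorph_sum => /fmorph_inj <-.
have imS : [set to g s | g in S] = S.
  apply: fourier_set_inj => b; rewrite -[RHS]fixS rmorph_sum big_imset /=; last first.
    by move=> g h _ _; apply: (@act_inj _ _ _ to).
  by apply: eq_bigr => g _; rewrite gal_sum_char.
by rewrite -{1}imS (mem_imset _ _ (@act_inj _ _ _ to s)).
Qed.

Let Zmod_expgN i (x : Zmod (n i)) : (x ^+ N = 1)%g.
Proof. by apply: (Zmod_expg (w_prim i)); rewrite (bigD1 i) //= dvdn_mulr. Qed.

Local Notation toZ i := (gal_power z_prim (@Zmod_expgN i)).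

Lemma orbit_products_cover g : g != 1%g -> exists2 P, P \in orbit_products n z K & g \in P.
Proof.
move=> g_neq1; have orbg i : g i \in gal_orbit N z K (g i).
  by rewrite (gal_orbitE z_prim (@Zmod_expgN i)) orbit_refl.
have gP : g \in setXn [ffun i => gal_orbit N z K (g i)].
  by apply/setXnP => i; rewrite ffunE orbg.
exists (setXn [ffun i => gal_orbit N z K (g i)]) => //.
rewrite !inE; apply/andP; split.
  by apply: contraTneq gP => ->; rewrite inE.
apply/imsetP; exists [ffun i => gal_orbit N z K (g i)] => //.
by rewrite inE; apply/forallP => i; rewrite ffunE; apply: imset_f.
Qed.

Lemma card_orbits_in_product P g : P \in orbit_products n z K -> g \in P ->
  (#|orbit to H @: P| * degree_over <<1 & [seq w i ^+ g i | i : 'I_m]>> K)%N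
    = (\prod_i degree_over <<1; w i ^+ g i>> K)%N.
Proof.
case/setD1P => _ /imsetP[p /[!inE] /forallP pO ->] /setXnP gp.
have pE i : p i = orbit (toZ i) H (g i).
  have /imsetP[x _ pix] := pO i; have := gp i.
  by rewrite pix (gal_orbitE z_prim (@Zmod_expgN i)) => /orbit_eqP ->.
have actP : [acts H, on setXn p | to].
  apply/subsetP => s Hs; rewrite !inE; apply/subsetP => h /setXnP hp.
  rewrite inE; apply/setXnP => i; have := hp i; rewrite pE; apply: orbit_trans.
  by apply/orbitP; exists s; rewrite //= sumZ_expgE.
(* The product is counted twice: by its orbits, all of one length, and by its factors, each a
   component orbit. *)
rewrite -(card_uniform_partition _ (orbit_partition actP)).
  rewrite cardsXn; apply: eq_bigr => i _; rewrite pE.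
  rewrite (card_orbit_gal_power z_prim (@Zmod_expgN i) (rs := [:: w i ^+ g i])) //.
  - by rewrite /degree_over /= adjoin_seq1.
  - by move=> _ /[!inE] /eqP ->; rewrite exprAC expw expr1n.
  move=> e; rewrite (Zmod_expg_fix (w_prim i)); split; last by apply; rewrite inE.
  by move=> fix_e r /[!inE] /eqP ->.
move=> _ /imsetP[h /setXnP hp ->]; apply: card_orbit_gal_power => //.
  by move=> _ /mapP[i _ ->]; rewrite exprAC expw expr1n.
(* [h i] and [g i] are powers of each other, so the same exponents fix them; hence every orbit in
   the product has the length computed from [g]. *)
have fixE e i : (h i ^+ e = h i)%g <-> (g i ^+ e = g i)%g.
  have := hp i; rewrite pE => hg; have := hg; rewrite orbit_sym => gh.
  have pow (x y : Zmod (n i)) : x \in orbit (toZ i) H y -> (y ^+ e = y)%g -> (x ^+ e = x)%g.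
    by case/orbitP => s _ <- /= ye; rewrite expgAC ye.
  by split; apply: pow.
move=> e; split=> [he _ /mapP[i _ ->] | ge].
  by apply/(Zmod_expg_fix (w_prim i)); apply/fixE; rewrite -sumZ_expgE he.
apply/ffunP => i; rewrite sumZ_expgE; apply/fixE; apply/(Zmod_expg_fix (w_prim i)).
by apply: ge; apply: map_f; rewrite mem_enum.
Qed.

Lemma card_integral_cayley_le (iota : {rmorphism L -> algC}) :
  (#|[set cayley_digraph S | S : {set G}
       & (1%g \notin S) && `[< alg_integral_over iota K (cayley_digraph S) >]]|
    <= 2 ^ \sum_(P in orbit_products n z K) #|orbit to H @: P|)%N.
Proof.
(* The digraphs are at most as many as their connection sets, which are [H]-invariant subsets of the
   nonzero elements. *)
apply: leq_trans (leq_imset_card _ _) _.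
apply: (@leq_trans (2 ^ #|orbit to H @: [set~ 1%g]|)).
  apply: leq_trans (card_acts_le to H _); apply/subset_leq_card/subsetP => S.
  rewrite !inE => /andP[S1 /asboolP /acts_of_integral ->]; rewrite andbT.
  by apply/subsetP => g Sg; rewrite !inE; apply: contraNneq S1 => <-.
rewrite leq_exp2l //.
(* Union bound over the products, which cover the nonzero elements. *)
have subU : orbit to H @: [set~ 1%g] \subset \bigcup_(P in orbit_products n z K) (orbit to H @: P).
  apply/subsetP => _ /imsetP[g /[!inE] /orbit_products_cover[P PG gP] ->].
  by apply/bigcupP; exists P => //; apply: imset_f.
apply: leq_trans (subset_leq_card subU) _.
apply: (big_ind2 (fun (A : {set {set G}}) k => #|A| <= k)%N) => //.
  by rewrite cards0.
move=> A i B j leA leB; apply: leq_trans (leq_add leA leB).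
by rewrite -cardsUI leq_addr.
Qed.

End SumZ.

Theorem mainTheorem2 (R : realType) (m : nat) (n : 'I_m -> nat)
    (n_gt0 : forall i, (0 < n i)%N)
    (L : splittingFieldType rat) (iota : {rmorphism L -> algC})
    (z : L) (z_prim : (\prod_i n i)%N.-primitive_root z)
    (w : 'I_m -> L) (w_prim : forall i, (n i).-primitive_root (w i))
    (K : {subfield L}) (sKz : (K <= <<1; z>>)%VS)
    (a : {set sumZ n} -> sumZ n)
    (aP : forall P, P \in orbit_products n z K -> a P \in P) :
  (#|[set cayley_digraph S | S : {set sumZ n}
       & (1%g \notin S) && `[< alg_integral_over iota K (cayley_digraph S) >]]|%:R : R)
  <= 2 `^ ratr (rGK z w K a).
Proof.
set toP := fun P : {set sumZ n} =>
  orbit (gal_power z_prim (sumZ_expg w_prim)) 'Gal(<<1; z>> / K)%g @: P.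
pose r := (\sum_(P in orbit_products n z K) #|toP P|)%N.
(* Each quotient in [rGK] is the number of orbits inside [P], so the real exponent is a natural
   number. *)
have rE : rGK z w K a = r%:R.
  rewrite natr_sum; apply: eq_bigr => P PG.
  rewrite -(card_orbits_in_product w_prim z_prim sKz PG (aP P PG)) natrM mulfK //.
  by rewrite Num.Theory.pnatr_eq0 -lt0n divn_gt0 ?adim_gt0 // dimvS ?capvSl.
rewrite rE ratr_nat powR_mulrn ?Num.Theory.ler0n // -natrX Num.Theory.ler_nat.
exact: card_integral_cayley_le.
Qed.
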